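(* Let $G$ be a finite simple graph. Then $G$ is a proper color-line graph if and only if there exists a family $\mathcal{Q}$ of cliques of $G$ such that (a) every vertex of $G$ belongs to at most three members of $\mathcal{Q}$, and every edge of $G$ belongs to exactly one member of $\mathcal{Q}$; (b) letting $W\subseteq V(G)$ be the set of vertices belonging to exactly three members of $\mathcal{Q}$, there is a mapping $W\to\mathcal{Q}$, $v\mapsto Q_v$, such that (b1) $v\in Q_v$ for all $v\in W$, and (b2) for all $u,v\in W$: if $u\in Q_v$ then $Q_u=Q_v$, and if $u\notin Q_v$ then $Q_u\cap Q_v=\emptyset$.
   Context: All graphs are finite and simple. An edge coloring of a graph $H$ is a map $\phi:E(H)\to\mathcal{C}$; it is proper if any two distinct edges sharing an endvertex get different colors. For an edge-colored graph $(H,\phi)$, the color-line graph $\mathrm{CL}(H)$ has vertex set $E(H)$, two distinct vertices being adjacent iff the corresponding edges of $H$ share an endvertex or have the same color. A graph $G$ is a proper color-line graph if it is isomorphic to $\mathrm{CL}(H)$ for some graph $H$ with a proper edge coloring. A clique is a set of pairwise adjacent vertices; an edge $uv$ belongs to a clique $Q$ if $u,v\in Q$. *)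

(* Defs.v *)
From HB Require Import structures.
From mathcomp Require Import all_boot.
Set Implicit Arguments.
Unset Strict Implicit.
Unset Printing Implicit Defensive.

Record sgraph := SGraph {
  svertex :> finType;
  adj : rel svertex;
  adj_sym : symmetric adj;
  adj_irrefl : irreflexive adj }.

Definition isomorphic (G H : sgraph) : Prop :=
  exists2 f : G -> H, bijective f & forall x y, adj (f x) (f y) = adj x y.

Definition edges (H : sgraph) : {set {set H}} :=
  [set [set p.1; p.2] | p : H * H & adj p.1 p.2].

Definition edge (H : sgraph) : finType := {a : {set H} | a \in edges H}.

Definition share_endvertex (H : sgraph) : rel (edge H) :=
  fun a b => [exists x : H, (x \in val a) && (x \in val b)].

Definition proper_coloring (H : sgraph) (C : eqType) (phi : edge H -> C) : Prop :=
  forall a b : edge H, a != b -> share_endvertex a b -> phi a != phi b.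

Section ColorLine.
Variables (H : sgraph) (C : eqType) (phi : edge H -> C).

Definition CL_adj : rel (edge H) :=
  fun a b => (a != b) && (share_endvertex a b || (phi a == phi b)).

Lemma CL_adj_sym : symmetric CL_adj.
Proof.
move=> a b; rewrite /CL_adj eq_sym [phi a == _]eq_sym; congr (_ && (_ || _)).
by apply: eq_existsb => x; rewrite andbC.
Qed.

Lemma CL_adj_irrefl : irreflexive CL_adj.
Proof. by move=> a; rewrite /CL_adj eqxx. Qed.

Definition CL : sgraph := SGraph CL_adj_sym CL_adj_irrefl.
End ColorLine.

Definition proper_color_line_graph (G : sgraph) : Prop :=
  exists (H : sgraph) (C : eqType) (phi : edge H -> C),
    proper_coloring phi /\ isomorphic G (CL phi).

Definition clique (G : sgraph) (A : {set G}) : Prop :=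
  {in A &, forall u v, u != v -> adj u v}.

Definition members_at (G : sgraph) (Q : {set {set G}}) (v : G) : {set {set G}} :=
  [set A in Q | v \in A].

Definition in_three (G : sgraph) (Q : {set {set G}}) : {set G} :=
  [set v | #|members_at Q v| == 3].

(* Main.v *)
Require Import Defs.
From mathcomp Require Import all_boot.

(** In a proper edge coloring of a simple graph, two adjacent vertices of the
    color-line graph either share exactly one endvertex or have the same color,
    never both; so the stars and color classes with at least two elements cover
    each edge once, and the color classes serve as the cliques [Q_v].
    Conversely, the cliques [Q_v] are pairwise disjoint and become color
    classes.  A vertex of [G] lies in at most two of the other cliques; these
    cliques, padded with private dummy endpoints, are the vertices of [H], and
    a vertex [v] of [G] becomes the edge joining the cliques containing [v]. *)

Set Implicit Arguments.
Unset Strict Implicit.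
Unset Printing Implicit Defensive.

(** * Edges as two-element sets *)

Lemma edgesP (H : sgraph) (a : {set H}) :
  reflect (exists x y, adj x y /\ a = [set x; y]) (a \in edges H).
Proof.
apply: (iffP imsetP) => [[[x y]]|[x [y [xy ->]]]].
  by rewrite inE /= => xy ->; exists x, y.
by exists (x, y); rewrite ?inE.
Qed.

Lemma card_edge (H : sgraph) (a : edge H) : #|val a| = 2.
Proof.
have /edgesP[x [y [xy ->]]] := valP a; rewrite cards2.
by case: eqP xy => // ->; rewrite adj_irrefl.
Qed.

(** Applied to edges, this rules out parallel edges: two distinct endvertices determine an edge. *)
Lemma eq_set_of_card2 (T : finType) (A B : {set T}) x y :
  #|A| = 2 -> #|B| = 2 -> x != y ->
  x \in A -> y \in A -> x \in B -> y \in B -> A = B.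
Proof.
move=> cA cB xy xA yA xB yB.
have sub (C : {set T}) : #|C| = 2 -> x \in C -> y \in C -> [set x; y] = C.
  move=> cC xC yC; apply/eqP; rewrite eqEcard cards2 xy cC leqnn andbT.
  by apply/subsetP => z; rewrite !inE => /orP[] /eqP->.
by rewrite -(sub A) // (sub B).
Qed.

(** * From a proper edge coloring to a family of cliques *)

Section CliquesOfColoring.
Variables (G H : sgraph) (C : eqType) (phi : edge H -> C) (f : G -> CL phi).
Hypotheses (phi_proper : proper_coloring phi) (f_inj : injective f).
Hypothesis f_adj : forall x y, adj (f x) (f y) = adj x y.

Let edge_of (v : G) : edge H := f v.
Let star (x : H) : {set G} := [set v | x \in val (edge_of v)].
Let color_class (v : G) : {set G} :=
  [set u | phi (edge_of u) == phi (edge_of v)].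
Let family : {set {set G}} :=
  [set A : {set G} | (1 < #|A|) &&
     ([exists x, A == star x] || [exists v, A == color_class v])].

Let adjE u v : adj u v = (u != v) &&
  (share_endvertex (edge_of u) (edge_of v)
   || (phi (edge_of u) == phi (edge_of v))).
Proof. by rewrite -f_adj /= /CL_adj (inj_eq f_inj). Qed.

Let shareP u v :
  reflect (exists x, u \in star x /\ v \in star x)
          (share_endvertex (edge_of u) (edge_of v)).
Proof.
apply: (iffP existsP) => -[x]; first by case/andP=> ux vx; exists x; rewrite !inE.
by rewrite !inE => -[ux vx]; exists x; rewrite ux.
Qed.

Let color_class_eq u v : u \in color_class v -> color_class u = color_class v.
Proof. by rewrite inE => /eqP uv; apply/setP=> w; rewrite !inE uv. Qed.

(** This is where properness enters: a common star gives a shared endvertex, hence different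
    colors. *)
Let star_not_same_color u v x w : u != v -> u \in star x -> v \in star x ->
  u \in color_class w -> v \in color_class w -> False.
Proof.
move=> uv ux vx; rewrite !inE => /eqP uw /eqP vw.
have fuv : edge_of u != edge_of v by rewrite /edge_of (inj_eq f_inj).
have /negP[] := phi_proper fuv (introT (shareP u v) (ex_intro _ x (conj ux vx))).
by rewrite uw vw.
Qed.

Let familyP A : A \in family ->
  (exists x, A = star x) \/ (exists v, A = color_class v).
Proof.
rewrite inE => /andP[_ /orP[] /existsP[z /eqP->]]; [left|right]; by exists z.
Qed.

(** Two vertices in two different stars would be the same edge of [H], a star and a color class are
    separated by properness, and color classes partition the vertices. *)
Let family_eq A B u v : A \in family -> B \in family -> u != v ->
  u \in A -> v \in A -> u \in B -> v \in B -> A = B.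
Proof.
move=> /familyP[] [x ->] /familyP[] [y ->] uv ux vx uy vy.
- have [-> //|xy] := eqVneq x y.
  case/negP: uv; rewrite -(inj_eq f_inj) -[f u == _]/(edge_of u == edge_of v).
  move: ux vx uy vy; rewrite !inE => ux vx uy vy.
  apply/eqP/val_inj.
  by apply: (@eq_set_of_card2 _ _ _ x y); rewrite ?card_edge.
- by case: (star_not_same_color uv ux vx uy vy).
- by case: (star_not_same_color uv uy vy ux vx).
- by rewrite -(color_class_eq ux) (color_class_eq uy).
Qed.

Let family_clique A : A \in family -> clique A.
Proof.
move=> /familyP[] [x ->] u v ux vx uv; rewrite adjE uv /=.
  by apply/orP; left; apply/shareP; exists x.
by move: ux vx; rewrite !inE => /eqP-> /eqP->; rewrite eqxx orbT.
Qed.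

Let family_cover u v : adj u v ->
  exists! A : {set G}, A \in family /\ (u \in A /\ v \in A).
Proof.
rewrite adjE => /andP[uv uv_adj].
have [A [AF uA vA]] : exists A, [/\ A \in family, u \in A & v \in A].
  have inF (A : {set G}) : u \in A -> v \in A ->
      [exists x, A == star x] || [exists w, A == color_class w] ->
      A \in family.
    move=> uA vA kA; rewrite inE kA andbT.
    by apply/card_gt1P; exists u, v.
  case/orP: uv_adj => [/shareP[x [ux vx]]|/eqP uv_color].
    exists (star x); split=> //; apply: inF => //.
    by apply/orP; left; apply/existsP; exists x.
  have [uK vK] : u \in color_class v /\ v \in color_class v.
    by rewrite !inE uv_color.
  exists (color_class v); split=> //; apply: inF => //.
  by apply/orP; right; apply/existsP; exists v.
by exists A; split=> // B [BF [uB vB]]; apply: (family_eq AF BF uv).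
Qed.

Let members_sub v : exists x y,
  members_at family v \subset [set star x; star y; color_class v].
Proof.
have /edgesP[x [y [_ fv]]] := valP (edge_of v).
exists x, y; apply/subsetP => A; rewrite inE => /andP[/familyP[] [z ->] vz].
  by move: vz; rewrite inE fv !inE => /orP[] /eqP->; rewrite eqxx ?orbT.
by rewrite (color_class_eq vz) !inE eqxx !orbT.
Qed.

Let card_three (T : finType) (a b c : T) : #|[set a; b; c]| <= 3.
Proof.
by rewrite -setUA !cardsU1 cards1; case: (a \notin _); case: (b \notin _).
Qed.

(** Only the two stars at the ends of [v] and its color class can be members at [v]. When three
    members occur, counting forces all of these candidates to be in the family. *)
Let color_class_family v : v \in in_three family -> color_class v \in family.
Proof.
rewrite inE => /eqP cv; have [x [y sub]] := members_sub v.
have /eqP mv : members_at family v == [set star x; star y; color_class v].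
  by rewrite eqEcard sub cv card_three.
have : color_class v \in members_at family v by rewrite mv !inE eqxx !orbT.
by rewrite inE => /andP[].
Qed.

Lemma cliques_of_coloring : exists Q : {set {set G}},
  [/\ forall A : {set G}, A \in Q -> clique A,
      (forall v : G, #|members_at Q v| <= 3) /\
      (forall u v : G, adj u v ->
         exists! A : {set G}, A \in Q /\ (u \in A /\ v \in A))
    & exists q : {v : G | v \in in_three Q} -> {A : {set G} | A \in Q},
        (forall v, val v \in val (q v)) /\
        (forall u v, (val u \in val (q v) -> q u = q v) /\
           (val u \notin val (q v) -> val (q u) :&: val (q v) = set0))].
Proof.
exists family; split; [exact: family_clique | split; last exact: family_cover |].
  move=> v; have [x [y sub]] := members_sub v.
  exact: leq_trans (subset_leq_card sub) (card_three _ _ _).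
exists (fun v => exist _ (color_class (val v)) (color_class_family (valP v))).
split=> [v|u v]; first by rewrite /= inE.
split=> [uv|]; first by apply: val_inj; apply: color_class_eq.
rewrite /= => uv; apply/setP => w; rewrite in_setI in_set0.
(* A common vertex [w] would make both color classes equal to that of [w]. *)
apply: contraNF uv => /andP[wu /color_class_eq <-].
by rewrite (color_class_eq wu) inE.
Qed.

End CliquesOfColoring.

(** * From cliques with a disjoint subfamily [K] to a proper edge coloring *)

Section ColoringOfCliques.
Variables (G : sgraph) (Q K : {set {set G}}).
Hypothesis Q_clique : forall A, A \in Q -> clique A.
Hypothesis Q_cover : forall u v : G, adj u v ->
  exists! A : {set G}, A \in Q /\ (u \in A /\ v \in A).
Hypothesis KQ : K \subset Q.
Hypothesis K_disjoint : forall A B v,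
  A \in K -> B \in K -> v \in A -> v \in B -> A = B.

Let ends (v : G) : {set {set G}} := members_at (Q :\: K) v.
Hypothesis ends_le2 : forall v, #|ends v| <= 2.

Let Q_eq A B u v : A \in Q -> B \in Q -> u != v ->
  u \in A -> v \in A -> u \in B -> v \in B -> A = B.
Proof.
move=> AQ BQ uv uA vA uB vB.
have [X [_ uX]] := Q_cover (Q_clique AQ uA vA uv).
by rewrite -(uX A) // -(uX B).
Qed.

Let V : finType := ({set G} + G * bool)%type.

(** There are [2 - #|ends v|] dummies; the [set0] branch covers [#|ends v| >= 2]. The first
    component of a dummy records its owner, so different vertices never share one. *)
Let dummies (v : G) : {set G * bool} :=
  if #|ends v| is n.+1 then if n is 0 then [set (v, true)] else set0
  else [set (v, true); (v, false)].

Let end_set (v : G) : {set V} := (inl @: ends v) :|: (inr @: dummies v).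

Let mem_end_inl A v : (inl A \in end_set v) = (A \in ends v).
Proof.
rewrite inE (mem_imset _ _ (@inl_inj _ _)) orbC.
by case: imsetP => [[]|].
Qed.

Let mem_end_inr d v : (inr d \in end_set v) = (d \in dummies v).
Proof.
rewrite inE (mem_imset _ _ (@inr_inj _ _)).
by case: imsetP => [[]|].
Qed.

Let dummies_owner d v : d \in dummies v -> d.1 = v.
Proof.
rewrite /dummies; case: #|_| => [|[|n]]; rewrite !inE //.
  by case/orP => /eqP->.
by move/eqP->.
Qed.

Let card_end_set v : #|end_set v| = 2.
Proof.
rewrite cardsU (_ : _ :&: _ = set0); last first.
  apply/setP => z; rewrite !inE; apply/negP => /andP[/imsetP[A _ ->]].
  by case/imsetP.
rewrite cards0 subn0 !card_imset; [|exact: inr_inj|exact: inl_inj].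
rewrite /dummies; have := ends_le2 v.
by case: #|ends v| => [|[|[|n]]] // _; rewrite ?cards2 ?xpair_eqE ?andbF ?cards1 ?cards0.
Qed.

Let end_set_meet u v : u != v -> forall z, z \in end_set u -> z \in end_set v ->
  exists2 A, z = inl A & [/\ A \in Q, A \notin K, u \in A & v \in A].
Proof.
move=> uv [A|d]; last first.
  rewrite !mem_end_inr => /dummies_owner du /dummies_owner dv.
  by case/eqP: uv; rewrite -du.
rewrite !mem_end_inl !inE => /andP[/andP[AK AQ] uA] /andP[_ vA].
by exists A.
Qed.

(** If distinct [u] and [v] had the same two ends, neither end could be a dummy, so two different
    cliques would contain both vertices, against the unique cover. *)
Let end_set_inj : injective end_set.
Proof.
move=> u v uv_eq; apply/eqP/negPn/negP => uv.
have /eqP/cards2P[x [y [xy uE]]] := card_end_set u.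
have [|//|A xA [AQ _ uA vA]] := end_set_meet uv (z := x).
- by rewrite uE !inE eqxx.
- by rewrite -uv_eq uE !inE eqxx.
have [|//|B yB [BQ _ uB vB]] := end_set_meet uv (z := y).
- by rewrite uE !inE eqxx orbT.
- by rewrite -uv_eq uE !inE eqxx orbT.
by case/eqP: xy; rewrite xA yB (Q_eq AQ BQ uv).
Qed.

Let H_adj : rel V := fun x y => (x != y) && [exists v, end_set v == [set x; y]].

Let H_adj_sym : symmetric H_adj.
Proof.
by move=> x y; rewrite /H_adj eq_sym; congr andb; apply: eq_existsb => v;
  rewrite setUC.
Qed.

Let H_adj_irrefl : irreflexive H_adj.
Proof. by move=> x; rewrite /H_adj eqxx. Qed.

Let H : sgraph := SGraph H_adj_sym H_adj_irrefl.

Let end_set_edge v : (end_set v : {set H}) \in edges H.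
Proof.
have /eqP/cards2P[x [y [xy vE]]] := card_end_set v.
apply/edgesP; exists x, y; split=> //=; rewrite /H_adj xy /=.
by apply/existsP; exists v; rewrite vE.
Qed.

Let to_edge v : edge H := exist _ (end_set v) (end_set_edge v).

Let edge_end_set (a : edge H) : exists v, end_set v == val a.
Proof.
have /edgesP[x [y [/andP[_ /existsP[v /eqP vE]] ->]]] := valP a.
by exists v; rewrite vE.
Qed.

Let of_edge (a : edge H) : G := xchoose (edge_end_set a).

Let of_edgeK : cancel of_edge to_edge.
Proof. by move=> a; apply: val_inj; apply/eqP/(xchooseP (edge_end_set a)). Qed.

Let to_edgeK : cancel to_edge of_edge.
Proof. by move=> v; apply: end_set_inj; apply: (congr1 val (of_edgeK _)). Qed.

(* The color of [v] is the clique of [K] containing it, or [{v}] if none does. *)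
Let color (v : G) : {set G} := v |: \bigcup_(A in K | v \in A) A.

(** Since [u] lies in its own color, equal colors put [u] into a clique of [K] through [v].
    Conversely, by disjointness the union defining the color has a single term, for any vertex of a
    clique of [K]. *)
Let colorP u v : u != v ->
  reflect (exists2 A, A \in K & u \in A /\ v \in A) (color u == color v).
Proof.
move=> uv; apply: (iffP eqP) => [uv_color|[A AK [uA vA]]].
  have : u \in color v by rewrite -uv_color !inE eqxx.
  rewrite !inE (negPf uv) /= => /bigcupP[A /andP[AK vA] uA].
  by exists A.
have colorA w : w \in A -> color w = A.
  move=> wA; apply/setP => z; rewrite !inE; apply/idP/idP.
    case/orP=> [/eqP->//|/bigcupP[B /andP[BK wB] zB]].
    by rewrite (K_disjoint AK BK wA wB).
  by move=> zA; apply/orP; right; apply/bigcupP; exists A; rewrite ?AK.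
by rewrite !colorA.
Qed.

Let phi (a : edge H) : {set G} := color (of_edge a).

Let shareP u v : u != v ->
  reflect (exists2 A, A \in Q :\: K & u \in A /\ v \in A)
          (share_endvertex (to_edge u) (to_edge v)).
Proof.
move=> uv; apply: (iffP existsP) => [[z /andP[zu zv]]|[A AN [uA vA]]].
  have [A _ [AQ AK uA vA]] := end_set_meet uv zu zv.
  by exists A; rewrite ?inE ?AK.
have mem w : w \in A -> inl A \in end_set w.
  by move=> wA; rewrite mem_end_inl inE AN.
by exists (inl A); rewrite /= !mem.
Qed.

Lemma coloring_of_cliques : proper_color_line_graph G.
Proof.
exists H, {set G}, phi; split=> [a b|].
  rewrite -[a]of_edgeK -[b]of_edgeK (inj_eq (can_inj to_edgeK)) => ab.
  case/(shareP ab) => A; rewrite inE => /andP[AK AQ] [aA bA].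
  rewrite /phi !to_edgeK; apply/(colorP ab) => -[B BK [aB bB]].
  (* A shared endvertex gives a clique outside [K], a common color one inside [K]; uniqueness of the
     cover identifies them. *)
  by case/negP: AK; rewrite (Q_eq AQ (subsetP KQ B BK) ab).
exists to_edge => [|u v]; first by exists of_edge.
rewrite /= /CL_adj (inj_eq (can_inj to_edgeK)) /phi !to_edgeK.
have [->|uv] := eqVneq u v; first by rewrite adj_irrefl.
apply/orP/idP => [|uv_adj].
  by case=> [/(shareP uv)|/(colorP uv)] [A AX [uA vA]]; apply: (Q_clique _ uA vA uv);
    [case/setDP: AX | apply: (subsetP KQ)].
have [A [[AQ [uA vA]] _]] := Q_cover uv_adj.
(* The clique covering [uv] yields a common color if it is in [K], a shared endvertex otherwise. *)
have [AK|AK] := boolP (A \in K); [right|left].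
  by apply/(colorP uv); exists A.
by apply/(shareP uv); exists A; rewrite ?inE ?AK.
Qed.

End ColoringOfCliques.

Theorem theorem4 (G : sgraph) :
  proper_color_line_graph G <->
  exists Q : {set {set G}},
    [/\ forall A : {set G}, A \in Q -> clique A,
        (forall v : G, #|members_at Q v| <= 3) /\
        (forall u v : G, adj u v ->
           exists! A : {set G}, A \in Q /\ (u \in A /\ v \in A))
      & exists q : {v : G | v \in in_three Q} -> {A : {set G} | A \in Q},
          (forall v, val v \in val (q v)) /\
          (forall u v, (val u \in val (q v) -> q u = q v) /\
                       (val u \notin val (q v) -> val (q u) :&: val (q v) = set0))].
Proof.
split=> [[H [C [phi [phi_proper [f /bij_inj f_inj f_adj]]]]]|].
  exact: cliques_of_coloring phi_proper f_inj f_adj.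
case=> Q [Q_clique [le3 Q_cover] [q [q_mem q_disj]]].
(* The chosen cliques become color classes; (b2) makes them pairwise disjoint. *)
pose K := [set val (q w) | w in [set: {v : G | v \in in_three Q}]].
apply: (@coloring_of_cliques G Q K Q_clique Q_cover).
- by apply/subsetP => A /imsetP[w _ ->]; apply: valP.
- move=> A B v /imsetP[u _ ->] /imsetP[w _ ->] vu vw.
  have [same disj] := q_disj u w.
  have [/same->//|/disj/setP/(_ v)] := boolP (val u \in val (q w)).
  by rewrite in_setI in_set0 vu vw.
move=> v.
have sub : members_at (Q :\: K) v \subset members_at Q v.
  by apply/subsetP => A; rewrite !inE => /andP[/andP[_ ->] ->].
have [v3|v3] := boolP (v \in in_three Q); last first.
  apply: leq_trans (subset_leq_card sub) _.
  by have := le3 v; rewrite leq_eqVlt ltnS; rewrite inE in v3; rewrite (negPf v3).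
pose w : {v : G | v \in in_three Q} := exist _ v v3.
have qK : val (q w) \in K by apply: imset_f; rewrite inE.
(* The bound 2 is restated as being below 3, the number of members at [v]. Strict inclusion then
   suffices, and the clique chosen for [v] is the one lost on removing [K]. *)
rewrite -ltnS; move: (v3); rewrite inE => /eqP <-.
apply: proper_card; rewrite properE sub; apply/subsetPn.
exists (val (q w)); rewrite !inE ?qK //.
by rewrite (valP (q w)) (q_mem w).
Qed.
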